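(* For every integer $n\ge 1$, \[\overline{p}(5n)\equiv (-1)^n\, r_3(n) \pmod 5.\]
   Context: An overpartition of a nonnegative integer $n$ is a partition of $n$ in which the first occurrence of each distinct part may (or may not) be overlined; $\overline{p}(n)$ denotes the number of overpartitions of $n$ (with $\overline{p}(0)=1$). Equivalently, $\sum_{n\ge0}\overline{p}(n)q^n=\prod_{k\ge1}\frac{1+q^k}{1-q^k}=1/\varphi(-q)$, where $\varphi(q)=\sum_{n=-\infty}^{\infty}q^{n^2}$. For an integer $k\ge1$, $r_k(n)$ denotes the number of representations of $n$ as an ordered sum of $k$ squares of integers, i.e. the number of $(x_1,\dots,x_k)\in\mathbb{Z}^k$ with $x_1^2+\cdots+x_k^2=n$. *)

(* Defs.v *)
From mathcomp Require Import all_boot all_order all_algebra.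
Set Implicit Arguments. Unset Strict Implicit. Unset Printing Implicit Defensive.
Import Order.TTheory GRing.Theory Num.Theory.

(* An overpartition of n: a nonincreasing list of parts (each part a positive
   integer, paired with a boolean "overlined" flag), summing to n, in which only
   the first occurrence of each distinct part may be overlined. *)
Definition is_overpartition (n : nat) (s : seq (nat * bool)) : bool :=
  [&& all (fun x => 0 < x.1) s,
      sorted geq (map fst s),
      sumn (map fst s) == n &
      all (fun i => (nth (0, false) s i).2 ==>
                    ((nth (0, false) s i).1 \notin map fst (take i s)))
          (iota 0 (size s))].

Fixpoint lists_upto (T : Type) (a : seq T) (k : nat) : seq (seq T) :=
  match k with
  | 0 => [:: [::]]
  | k'.+1 => [::] :: [seq x :: l | x <- a, l <- lists_upto a k']
  end.

(* Every overpartition of n has at most n parts, each in 1..n, so it appears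
   in this (duplicate-free) finite list of candidates. *)
Definition op_candidates (n : nat) : seq (seq (nat * bool)) :=
  undup (lists_upto [seq (p, b) | p <- iota 1 n, b <- [:: true; false]] n).

Definition pbar (n : nat) : nat := count (is_overpartition n) (op_candidates n).

(* r k n = number of (x_1,...,x_k) in Z^k with x_1^2+...+x_k^2 = n.
   Each such x_j satisfies |x_j| <= n, so we encode x_j as i - n with
   i : 'I_(2n+1), i.e. x_j ranges over [-n, n]. *)
Definition r (k n : nat) : nat :=
  #|[set x : k.-tuple 'I_(2 * n + 1) |
      ((\sum_(i <- x) ((Posz (i : nat) - Posz n) ^+ 2))%R == Posz n)]|.

(* Main.v *)
Require Import Defs.
From mathcomp Require Import all_boot all_order all_algebra.
From mathcomp Require Import zify ring.
Set Implicit Arguments. Unset Strict Implicit. Unset Printing Implicit Defensive.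
Import Order.TTheory GRing.Theory Num.Theory.

(** Put theta(q) = phi(-q) = sum_z (-1)^z q^(z^2) and P(q) = sum_n pbar(n) q^n.
    Gauss's identity gives P theta = 1; it is obtained here from the finite form
      theta_n (1+q)...(1+q^n) = (1-q)...(1-q^n) + terms divisible by q^(n+1),
    where theta_n is the sum over |z| <= n. Modulo 5 we have
    theta(q)^5 = theta(q^5), hence P(q) theta(q^5) = theta(q)^4. The coefficients
    of q^m and q^(5m) in theta^4 agree modulo 5: counting the factorizations
    x = u y of Lipschitz quaternions x of norm 5m, with u one of the six
    quaternions 1 +- 2i, 1 +- 2j, 1 +- 2k, gives r_4(5m) = r_4(m) mod 5, because
    each x has one or six such left divisors. Extracting the exponents divisible
    by 5 yields (sum_n pbar(5n) q^n) theta = theta^4, and theta cancels. *)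

(** * Enumeration of overpartitions *)

(* The flag [b] tells whether parts equal to the bound [k] may be overlined. *)
Fixpoint op_bounded (k : nat) (b : bool) (s : seq (nat * bool)) : bool :=
  if s is (p, c) :: s' then
    [&& 0 < p, p <= k, c ==> (p < k) || b & op_bounded p false s']
  else true.

Definition weight (s : seq (nat * bool)) : nat := sumn (map fst s).

(* [pre] is the list of parts that precede [s]. *)
Definition over_ok (pre s : seq (nat * bool)) : bool :=
  all (fun i => (nth (0, false) s i).2 ==>
      ((nth (0, false) s i).1 \notin map fst (pre ++ take i s))) (iota 0 (size s)).

Lemma over_ok_cons pre x s :
  over_ok pre (x :: s) =
  (x.2 ==> (x.1 \notin map fst pre)) && over_ok (rcons pre x) s.
Proof.
rewrite /over_ok /= cats0; congr (_ && _).
rewrite (iotaDl 1 0) all_map; apply: eq_all => i /=.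
by rewrite -cats1 -catA.
Qed.

(** In a nonincreasing list, a part has occurred earlier iff it equals its immediate predecessor.
    Hence the bound [k] and one flag record all that is needed of the prefix. *)
Lemma op_boundedE k b pre s :
  (forall p, 0 < p <= k -> (p \in map fst pre) = (p == k) && ~~ b) ->
  op_bounded k b s =
  [&& all (fun x => 0 < x.1) s, path geq k (map fst s) & over_ok pre s].
Proof.
elim: s k b pre => [|[p c] s IHs] k b pre Hpre //.
rewrite over_ok_cons /=.
have [p0|] := ltnP 0 p => //=.
have [pk|] := leqP p k; last by rewrite andbF.
rewrite /= Hpre ?p0 // (IHs p false (rcons pre (p, c))); last first.
  move=> p' /andP[p'0 p'p]; rewrite map_rcons mem_rcons inE /= andbT.
  case: eqP => //= neq; rewrite Hpre; last by lia.
  by case: eqP => //= e; lia.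
have -> : (p < k) || b = ~~ ((p == k) && ~~ b).
  by rewrite negb_and negbK ltn_neqAle pk andbT.
by rewrite andbCA; congr (_ && _); rewrite andbCA.
Qed.

Lemma weight_ge s x : x \in s -> x.1 <= weight s.
Proof.
elim: s => //= y s IHs; rewrite inE /weight /= => /orP[/eqP->|/IHs].
  exact: leq_addr.
by move=> h; apply: leq_trans h (leq_addl _ _).
Qed.

Lemma is_overpartitionE n k s : n <= k ->
  is_overpartition n s = op_bounded k true s && (weight s == n).
Proof.
move=> nk; rewrite (@op_boundedE k true [::]); last by move=> p _; rewrite andbF.
rewrite /is_overpartition -/(weight s) -/(over_ok [::] s).
case: eqP => [sn|]; last by rewrite !andbF.
rewrite andbT /=; congr [&& _, _ & _].
case: s sn => // x s sn /=.
suff -> : x.1 <= k by [].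
by apply: leq_trans nk; rewrite -sn weight_ge // mem_head.
Qed.

(* Prepends copies of the non-overlined part [k] to the lists enumerated by [E];
   any [fuel >= n] gives all of them when [k > 0]. *)
Fixpoint enum_plain (E : nat -> seq (seq (nat * bool))) (k fuel n : nat) :=
  E n ++ (if fuel is f.+1 then
            if k <= n then [seq (k, false) :: s | s <- enum_plain E k f (n - k)]
            else [::]
          else [::]).

Fixpoint enum_op (k n : nat) : seq (seq (nat * bool)) :=
  if k is j.+1 then
    enum_plain (enum_op j) k n n ++
    (if k <= n then [seq (k, true) :: s | s <- enum_plain (enum_op j) k (n - k) (n - k)]
     else [::])
  else if n == 0 then [:: [::]] else [::].

Definition enum_nonover j n := enum_plain (enum_op j) j.+1 n n.

Lemma enum_plain_fuel E k f n : 0 < k -> n <= f ->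
  enum_plain E k f n = enum_plain E k n n.
Proof.
move=> k0; elim/ltn_ind: f n => -[|f] IHf n nf.
  by move: nf; rewrite leqn0 => /eqP->.
case: n nf => [|n] nf /=; first by rewrite leqNgt k0.
congr (_ ++ _); case: ifP => // kn; congr map.
by rewrite IHf ?[RHS]IHf //; lia.
Qed.

(** Splitting on whether the part [j.+1] occurs; on generating functions this recursion becomes
    division by 1 - q^(j+1). *)
Lemma enum_nonoverE j n :
  enum_nonover j n = enum_op j n ++
    (if j < n then [seq (j.+1, false) :: s | s <- enum_nonover j (n - j.+1)]
     else [::]).
Proof.
rewrite {1}/enum_nonover; case: n => [|n] //=; congr (_ ++ _); case: ifP => // jn.
by rewrite enum_plain_fuel //; lia.
Qed.

Lemma enum_opS j n :
  enum_op j.+1 n = enum_nonover j n ++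
    (if j < n then [seq (j.+1, true) :: s | s <- enum_nonover j (n - j.+1)]
     else [::]).
Proof. by []. Qed.

Lemma op_bounded_widen j s : op_bounded j true s =
  op_bounded j.+1 false s && (if s is x :: _ then x.1 <= j else true).
Proof.
case: s => //= -[p c] s; rewrite orbF orbT implybT ltnS /=.
by have [pj|] := leqP p j; rewrite ?andbT ?andbF //= leqW // implybT.
Qed.

Lemma mem_if_map (c : bool) (x : nat * bool) l s :
  (s \in (if c then [seq x :: t | t <- l] else [::])) =
  c && (if s is y :: t then (y == x) && (t \in l) else false).
Proof.
case: c; last by rewrite in_nil.
case: s => [|y t]; first by apply/mapP => -[].
rewrite andTb; apply/mapP/andP => [[u ul [-> ->]]|[/eqP-> tl]] //.
by exists t.
Qed.

Lemma mem_enum_nonover j :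
  (forall n s, (s \in enum_op j n) = op_bounded j true s && (weight s == n)) ->
  forall n s, (s \in enum_nonover j n) = op_bounded j.+1 false s && (weight s == n).
Proof.
move=> H; elim/ltn_ind => n IHn s.
rewrite enum_nonoverE mem_cat H mem_if_map op_bounded_widen.
case: s => [|[p c] s]; first by rewrite andbF orbF.
case: (ltnP j n) => jn.
  rewrite IHn; last by lia.
  rewrite /weight /= xpair_eqE orbF.
  have [->|npj] := eqVneq p j.+1.
    rewrite !ltnn leqnn; case: c => //=.
    by rewrite andbF /=; congr (_ && _); lia.
  have -> : (p <= j.+1) = (p <= j) by lia.
  by rewrite /= orbF; case: (leqP p j) => //=; rewrite !(andbF, andbT).
rewrite /= orbF.
have [pj|pj] := leqP p j; first by rewrite andbT.
by rewrite andbF /weight /=; apply/esym/negbTE/negP => /andP[] ; lia.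
Qed.

Lemma mem_enum_op k n s :
  (s \in enum_op k n) = op_bounded k true s && (weight s == n).
Proof.
elim: k n s => [|j IHj] n s.
  case: s => [|[p c] s] /=; first by case: n.
  have -> : (0 < p) &&
      [&& p <= 0, c ==> (p < 0) || true & op_bounded p false s] = false by lia.
  by case: ifP.
rewrite enum_opS mem_cat mem_if_map !mem_enum_nonover //.
case: s => [|[p c] s]; first by rewrite andbF orbF.
rewrite mem_enum_nonover // /weight /= xpair_eqE !orbF orbT implybT.
have [->|npj] := eqVneq p j.+1.
  rewrite !ltnn leqnn; case: c => /=; last by rewrite !andbF orbF.
  by case: (op_bounded _ _ s) => /=; lia.
rewrite andbF orbF.
have [pj|] := ltnP j.+1 p; first by lia.
by rewrite leq_eqVlt (negbTE npj) /= => ->; rewrite implybT.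
Qed.

Lemma enum_nonover_uniq j n :
  (forall m, uniq (enum_op j m)) -> uniq (enum_nonover j n).
Proof.
move=> H; elim/ltn_ind: n => n IHn; rewrite enum_nonoverE cat_uniq H /=.
apply/andP; split; last first.
  case: ifP => // jn; rewrite map_inj_uniq; first by apply: IHn; lia.
  by move=> ? ? [].
apply/hasPn => s; rewrite mem_if_map mem_enum_op.
case: s => [|[p c] s]; first by rewrite /= andbF.
by case/and3P => _ /eqP[-> _] _ /=; rewrite ltnn.
Qed.

Lemma enum_op_uniq k n : uniq (enum_op k n).
Proof.
elim: k n => [|j IHj] n; first by rewrite /=; case: ifP.
rewrite enum_opS cat_uniq enum_nonover_uniq //=.
apply/andP; split; last first.
  case: ifP => // jn; rewrite map_inj_uniq; first exact: enum_nonover_uniq.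
  by move=> ? ? [].
apply/hasPn => s; rewrite mem_if_map mem_enum_nonover; last exact: mem_enum_op.
case: s => [|[p c] s]; first by rewrite /= andbF.
by case/and3P => _ /eqP[-> ->] _ /=; rewrite ltnn !andbF.
Qed.

Lemma mem_lists_upto (T : eqType) (a : seq T) k s :
  (s \in lists_upto a k) = (size s <= k) && all (mem a) s.
Proof.
elim: k s => [|k IHk] [|x s] //.
rewrite inE /= ltnS; apply/allpairsP/idP => [[[y l] /= [ya lk [-> ->]]]|].
  by rewrite ya -IHk lk.
by case/and3P=> sk xa sa; exists (x, s); rewrite /= xa IHk sk.
Qed.

Lemma op_bounded_pos k b s x : op_bounded k b s -> x \in s -> 0 < x.1.
Proof.
elim: s k b => //= -[p c] s IHs k b /and4P[p0 _ _ /IHs H].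
by rewrite inE => /orP[/eqP->|/H].
Qed.

Lemma size_op_bounded k b s : op_bounded k b s -> size s <= weight s.
Proof.
elim: s k b => //= -[p c] s IHs k b /and4P[p0 _ _ /IHs].
by rewrite /weight /=; lia.
Qed.

(** Parts never exceed the weight, so a single bound [k] serves all the coefficients up to q^k. *)
Lemma pbar_size_enum_op k n : n <= k -> pbar n = size (enum_op k n).
Proof.
move=> nk; rewrite /pbar -size_filter; apply: perm_size; apply: uniq_perm.
- exact/filter_uniq/undup_uniq.
- exact: enum_op_uniq.
move=> s; rewrite mem_filter mem_enum_op (is_overpartitionE _ nk) mem_undup.
rewrite mem_lists_upto; case: (boolP (op_bounded _ _ _ && _)) => // /andP[sk /eqP sn].
rewrite -{1}sn (size_op_bounded sk) !andTb; apply/allP => x xs.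
rewrite inE; apply/allpairsP; exists x; case: x xs => p c xs /=.
split=> //; last by case: c {xs}; rewrite !inE.
by rewrite mem_iota (op_bounded_pos sk xs) add1n ltnS -sn (weight_ge xs).
Qed.

Local Open Scope ring_scope.

(** * The finite form of Gauss's identity *)

Fixpoint zball (n : nat) : seq int :=
  if n is m.+1 then [:: m.+1%:Z, - m.+1%:Z & zball m] else [:: 0].

Lemma mem_zball n z : (z \in zball n) = (`|z| <= n)%N.
Proof.
elim: n => [|n IHn]; first by rewrite inE; lia.
by rewrite !inE IHn; lia.
Qed.

Lemma zball_uniq n : uniq (zball n).
Proof. by elim: n => //= n IHn; rewrite !inE !mem_zball IHn; lia. Qed.

Section Theta.
Variable R : comNzRingType.
Implicit Types n s m : nat.

Definition theta n : {poly R} := \sum_(z <- zball n) (-1) ^+ `|z|%N *: 'X^(`|z| ^ 2).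

Lemma theta0 : theta 0 = 1.
Proof. by rewrite /theta big_seq1 !expr0 scale1r. Qed.

Lemma thetaS n : theta n.+1 = theta n + 2%:R * (-1) ^+ n.+1 * 'X^(n.+1 ^ 2).
Proof.
rewrite /theta !big_cons abszN absz_nat -!mul_polyC rmorphXn rmorphN rmorph1.
ring.
Qed.

Definition qpoch m n : {poly R} := \prod_(m.+1 <= k < n.+1) (1 - 'X^k).
Definition qpochN n : {poly R} := \prod_(1 <= k < n.+1) (1 + 'X^k).

Lemma qpochS m n : (m <= n)%N -> qpoch m n.+1 = qpoch m n * (1 - 'X^(n.+1)).
Proof. by move=> mn; rewrite /qpoch big_nat_recr. Qed.

Lemma qpoch_split m n : (m < n)%N -> qpoch m n = (1 - 'X^(m.+1)) * qpoch m.+1 n.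
Proof. by move=> mn; rewrite /qpoch big_ltn. Qed.

Lemma qpochNS n : qpochN n.+1 = qpochN n * (1 + 'X^(n.+1)).
Proof. by rewrite /qpochN big_nat_recr. Qed.

Lemma qpoch_id n : qpoch n n = 1.
Proof. by rewrite /qpoch big_geq. Qed.

(** In classical notation, 2 (-1)^(s+1) q^((s+1)(n+1)) (q^(s+2); q)_(n-s-1) (-q; q)_s for s < n. The
    factor q^((s+1)(n+1)) makes it vanish modulo q^(n+1). *)
Definition gauss_term n s : {poly R} :=
  2%:R * (-1) ^+ s.+1 * 'X^(s.+1 * n.+1) * qpoch s.+1 n * qpochN s.

(** The summand s = m of the difference is the change of the right-hand side from m to m + 1, so the
    sum telescopes. *)
Lemma gauss_term_telescope n m : (m <= n)%N ->
  (qpoch 0 n.+1 + \sum_(s < m) gauss_term n.+1 s)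
    - (1 + 'X^(n.+1)) * (qpoch 0 n + \sum_(s < m) gauss_term n s)
  = 2%:R * (-1) ^+ m.+1 * 'X^(m.+1 * n.+1) * qpoch m n * qpochN m.
Proof.
elim: m => [|m IHm] mn.
  rewrite !big_ord0 qpochS // /qpochN big_geq // mul1n.
  ring.
rewrite !big_ord_recr /=.
have /eqP := IHm (ltnW mn); rewrite subr_eq => /eqP E.
rewrite addrA E /gauss_term qpochS // (qpoch_split mn) qpochNS.
rewrite (_ : 'X^(m.+1 * n.+2) = 'X^(m.+1 * n.+1) * 'X^(m.+1));
  last by rewrite -exprD; congr ('X^_); lia.
rewrite (_ : 'X^(m.+2 * n.+1) = 'X^(m.+1 * n.+1) * 'X^(n.+1));
  last by rewrite -exprD; congr ('X^_); lia.
rewrite !(exprS (-1)); ring.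
Qed.

Lemma theta_qpochN n :
  theta n * qpochN n = qpoch 0 n + \sum_(s < n) gauss_term n s.
Proof.
elim: n => [|n IHn].
  by rewrite theta0 /qpochN /qpoch !big_geq // big_ord0 addr0 mul1r.
rewrite thetaS mulrDl {1}qpochNS mulrA IHn mulrC.
have /eqP := gauss_term_telescope (leqnn n); rewrite subr_eq => /eqP E.
(* The summand s = n lies outside the telescoped range. Added to the telescoping remainder, it gives
   the new term of theta times [qpochN n.+1]. *)
rewrite big_ord_recr /= addrA E /gauss_term !qpoch_id qpochNS.
rewrite (_ : 'X^(n.+1 * n.+2) = 'X^(n.+1 * n.+1) * 'X^(n.+1));
  last by rewrite -exprD; congr ('X^_); lia.
rewrite -mulnn; ring.
Qed.
End Theta.

(** * The number of quaternions of norm 5m *)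

Definition quat : Type := int * int * (int * int).

Definition qnorm (x : quat) : int :=
  let: (a, b, (c, d)) := x in a * a + b * b + (c * c + d * d).
Definition qconj (x : quat) : quat :=
  let: (a, b, (c, d)) := x in (a, - b, (- c, - d)).
Definition qmul (x y : quat) : quat :=
  let: (a, b, (c, d)) := x in let: (a', b', (c', d')) := y in
  (a * a' - b * b' - c * c' - d * d', a * b' + b * a' + c * d' - d * c',
   (a * c' - b * d' + c * a' + d * b', a * d' + b * c' - c * b' + d * a')).
Definition qscale (k : int) (x : quat) : quat :=
  let: (a, b, (c, d)) := x in (k * a, k * b, (k * c, k * d)).
Definition q5div (x : quat) : bool :=
  let: (a, b, (c, d)) := x in [&& (5 %| a)%Z, (5 %| b)%Z, (5 %| c)%Z & (5 %| d)%Z].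

Lemma qnormM x y : qnorm (qmul x y) = qnorm x * qnorm y.
Proof. by case: x => [[a b] [c d]]; case: y => [[a' b'] [c' d']] /=; ring. Qed.

Lemma qmulVl x y : qmul (qconj x) (qmul x y) = qscale (qnorm x) y.
Proof.
case: x => [[a b] [c d]]; case: y => [[a' b'] [c' d']] /=.
by congr (_, _, (_, _)); ring.
Qed.

Lemma qmulVr x y : qmul x (qmul (qconj x) y) = qscale (qnorm x) y.
Proof.
case: x => [[a b] [c d]]; case: y => [[a' b'] [c' d']] /=.
by congr (_, _, (_, _)); ring.
Qed.

Lemma qmul_scale k x y : qmul x (qscale k y) = qscale k (qmul x y).
Proof.
case: x => [[a b] [c d]]; case: y => [[a' b'] [c' d']] /=.
by congr (_, _, (_, _)); ring.
Qed.

Lemma qscale5_inj : injective (qscale 5).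
Proof.
move=> [[a b] [c d]] [[a' b'] [c' d']] /= [] *.
by congr (_, _, (_, _)); lia.
Qed.

Lemma q5divP x : reflect (exists y, x = qscale 5 y) (q5div x).
Proof.
case: x => [[a b] [c d]] /=; apply: (iffP and4P).
  case=> /dvdzP[a' ->] /dvdzP[b' ->] /dvdzP[c' ->] /dvdzP[d' ->].
  by exists (a', b', (c', d')); rewrite /= ![5 * _]mulrC.
by case=> -[[a' b'] [c' d']] [-> -> -> ->]; split; apply: dvdz_mulr.
Qed.

(* One Lipschitz quaternion of norm 5 for each class modulo right multiplication
   by units. *)
Definition norm5 : seq quat :=
  [:: (1, 2, (0, 0)); (1, -2, (0, 0)); (1, 0, (2, 0)); (1, 0, (-2, 0));
      (1, 0, (0, 2)); (1, 0, (0, -2))].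

(* For [q] of norm 5: [q] is a left divisor of [x] iff 5 divides [qconj q * x]. *)
Definition ldiv (q x : quat) : bool := q5div (qmul (qconj q) x).

Definition qres (x : quat) : quat :=
  let: (a, b, (c, d)) := x in ((a %% 5)%Z, (b %% 5)%Z, ((c %% 5)%Z, (d %% 5)%Z)).

Lemma pchar_F5 : 5 \in [pchar 'F_5].
Proof. exact: pchar_Fp. Qed.

Lemma modz5_F5 (a : int) : (a %% 5)%Z%:~R = a%:~R :> 'F_5.
Proof.
have E : (5 : int)%:~R = 0 :> 'F_5 by apply/eqP; rewrite -(dvdz_pcharf pchar_F5).
by rewrite [in RHS](divz_eq a 5) [in RHS]intrD [in RHS]intrM E mulr0 add0r.
Qed.

Lemma ldiv_res q x : ldiv q (qres x) = ldiv q x.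
Proof.
case: q => [[a b] [c d]]; case: x => [[a' b'] [c' d']].
rewrite /ldiv /= !(dvdz_pcharf pchar_F5).
move: (modz5_F5 a') (modz5_F5 b') (modz5_F5 c') (modz5_F5 d').
move: (a' %% 5)%Z (b' %% 5)%Z (c' %% 5)%Z (d' %% 5)%Z => ? ? ? ? E1 E2 E3 E4.
by rewrite !(intrD, intrM, rmorphN) /= !intrM !rmorphN /= E1 E2 E3 E4.
Qed.

Lemma dvd5_qnorm_res x : (5 %| qnorm (qres x))%Z = (5 %| qnorm x)%Z.
Proof.
case: x => [[a b] [c d]]; rewrite /= !(dvdz_pcharf pchar_F5).
move: (modz5_F5 a) (modz5_F5 b) (modz5_F5 c) (modz5_F5 d).
move: (a %% 5)%Z (b %% 5)%Z (c %% 5)%Z (d %% 5)%Z => ? ? ? ? E1 E2 E3 E4.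
by rewrite !(intrD, intrM) E1 E2 E3 E4.
Qed.

Definition residues : seq quat :=
  let s := [seq k%:Z | k <- iota 0 5] in
  [seq (x, y) | x <- [seq (a, b) | a <- s, b <- s], y <- [seq (c, d) | c <- s, d <- s]].

(** A check of 625 classes. Modulo 5 the quaternions form the 2 by 2 matrices over F_5; a nonzero
    singular matrix has as image one of the six lines of the plane, and each q in [norm5] accounts
    for one line. For x = 0 all six q count. *)
Lemma count_ldiv_residues :
  all (fun x => (5 %| qnorm x)%Z ==> ((count (ldiv^~ x) norm5) %% 5 == 1)%N) residues.
Proof. by vm_compute. Qed.

Lemma qres_residues x : qres x \in residues.
Proof.
have H (a : int) : (a %% 5)%Z \in [seq k%:Z | k <- iota 0 5].
  apply/mapP; exists (absz (a %% 5)%Z); last by lia.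
  by rewrite mem_iota; lia.
by case: x => [[a b] [c d]]; rewrite /= !allpairs_f.
Qed.

Lemma count_ldiv x : (5 %| qnorm x)%Z -> count (ldiv^~ x) norm5 = 1 %[mod 5].
Proof.
move=> x5; have /allP/(_ _ (qres_residues x)) := count_ldiv_residues.
by rewrite dvd5_qnorm_res x5 (eq_count (ldiv_res^~ x)) => /eqP.
Qed.

Definition qball (M : nat) : seq quat :=
  let s := [seq (a, b) | a <- zball M, b <- zball M] in [seq (x, y) | x <- s, y <- s].

Definition qsphere (M m : nat) : seq quat :=
  [seq x <- qball M | qnorm x == m%:Z].

Lemma qsphere_uniq M m : uniq (qsphere M m).
Proof.
apply: filter_uniq; do 2 (apply: allpairs_uniq; last by move=> [? ?] [? ?] _ _ [-> ->]).
all: try apply: allpairs_uniq; try exact: zball_uniq.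
all: by move=> [? ?] [? ?] _ _ [-> ->].
Qed.

(** Each coordinate satisfies |z| <= z^2 <= m. The box size [M] is independent of [m] so that norms
    m and 5m can share a box. *)
Lemma mem_qsphere M m x : (m <= M)%N -> (x \in qsphere M m) = (qnorm x == m%:Z).
Proof.
move=> mM; rewrite mem_filter; case: eqP => //.
case: x => [[a b] [c d]] /= E.
have H (z t : int) : z * z + t = m -> 0 <= t -> z \in zball M.
  move=> e t0; rewrite mem_zball; apply: leq_trans mM.
  suff : (`|z| <= z * z)%R by lia.
  by nia.
apply: allpairs_f; apply: allpairs_f.
- by apply: (H _ (b * b + (c * c + d * d))); nia.
- by apply: (H _ (a * a + (c * c + d * d))); nia.
- by apply: (H _ (a * a + b * b + d * d)); nia.
- by apply: (H _ (a * a + b * b + c * c)); nia.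
Qed.

Lemma qnorm_norm5 q : q \in norm5 -> qnorm q = 5.
Proof. by rewrite !inE => /or4P[||| /or3P[||]] /eqP->. Qed.

(** Left multiplication by q is a bijection from norm m onto the multiples of q of norm 5m, with
    inverse x -> conj(q) x / 5. *)
Lemma count_ldiv_qsphere M m q : (5 * m <= M)%N -> q \in norm5 ->
  count (ldiv q) (qsphere M (5 * m)) = size (qsphere M m).
Proof.
move=> mM /qnorm_norm5 q5; rewrite -(size_map (qmul q)) -size_filter.
apply: perm_size; apply: uniq_perm.
- exact/filter_uniq/qsphere_uniq.
- rewrite map_inj_uniq ?qsphere_uniq // => x y E.
  by apply: qscale5_inj; rewrite -q5 -!qmulVl E.
move=> x; rewrite mem_filter mem_qsphere //.
apply/andP/mapP => [[/q5divP[y E] /eqP xm]|[y]].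
  have Ex : x = qmul q y.
    by apply: qscale5_inj; rewrite -qmul_scale -E qmulVr q5.
  exists y => //; rewrite mem_qsphere; last by lia.
  by move: xm; rewrite Ex qnormM q5; lia.
rewrite mem_qsphere; last by lia.
move=> /eqP ym ->; split; last by rewrite qnormM q5 ym; lia.
by apply/q5divP; exists y; rewrite qmulVl q5.
Qed.

(* Double counting of the pairs (q, x) with q in [norm5] a left divisor of x. *)
Lemma size_qsphere_5 M m : (5 * m <= M)%N ->
  size (qsphere M (5 * m)) = size (qsphere M m) %[mod 5].
Proof.
move=> mM.
have E : (\sum_(x <- qsphere M (5 * m)) count (ldiv^~ x) norm5
          = 6 * size (qsphere M m))%N.
  under eq_bigr do rewrite -sum1_count big_mkcond.
  rewrite exchange_big /= big_seq.
  under eq_bigr => q qn do rewrite -big_mkcond sum1_count (count_ldiv_qsphere mM qn).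
  by rewrite -big_seq big_const_seq count_predT iter_addn_0 mulnC.
have <- : (6 * size (qsphere M m) = size (qsphere M m) %[mod 5])%N.
  by rewrite -modnMml mul1n.
rewrite -E -sum1_size !big_seq.
elim/big_ind2: _ => // [a b c d ac bd|x]; first by rewrite -modnDm ac bd modnDm.
rewrite mem_filter => /andP[/eqP xn _]; rewrite count_ldiv // xn.
by lia.
Qed.

(** * Power series identities as congruences modulo a power of X *)

Section Truncation.
Variable R : comNzRingType.
Implicit Types p q a b : {poly R}.

Definition eqX (N : nat) p q := forall i, (i < N)%N -> p`_i = q`_i.

Lemma eqX_trans N q p r : eqX N p q -> eqX N q r -> eqX N p r.
Proof. by move=> H1 H2 i iN; rewrite H1 ?H2. Qed.

Lemma eqX_mul N p p' q q' : eqX N p p' -> eqX N q q' -> eqX N (p * q) (p' * q').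
Proof.
move=> Hp Hq i iN; rewrite !coefM; apply: eq_bigr => j _.
by rewrite Hp ?Hq //; have := ltn_ord j; lia.
Qed.

Lemma eqX_mulr N p q r : eqX N p q -> eqX N (p * r) (q * r).
Proof. by move=> H; apply: eqX_mul. Qed.

Lemma eqX_exp N p q k : eqX N p q -> eqX N (p ^+ k) (q ^+ k).
Proof. by move=> H; elim: k => // k IHk; rewrite !exprS; apply: eqX_mul. Qed.

(** As [p] has constant term 1, the i-th coefficient of the product determines that of the cofactor
    from the lower ones. *)
Lemma eqX_cancel N p a b : p`_0 = 1 -> eqX N (p * a) (p * b) -> eqX N a b.
Proof.
move=> p0 H; elim/ltn_ind => i IHi iN.
have := H i iN; rewrite !coefM !big_ord_recl p0 !mul1r /= subn0.
rewrite [X in _ + X = _](eq_bigr (fun j : 'I_i => p`_(bump 0 j) * b`_(i - bump 0 j))).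
  by move/addIr.
by move=> j _; rewrite IHi // /bump; have := ltn_ord j; lia.
Qed.

Lemma theta_qpochN_eqX n : eqX n.+1 (theta R n * qpochN R n) (qpoch R 0 n).
Proof.
move=> i iN; rewrite theta_qpochN coefD coef_sum big1 ?addr0 // => s _.
set u := gauss_term _ _ _.
suff [v ->] : exists v, u = v * 'X^(s.+1 * n.+1).
  by rewrite coefMXn ifT //; lia.
exists (2%:R * (-1) ^+ s.+1 * qpoch R s.+1 n * qpochN R s).
rewrite /u /gauss_term; ring.
Qed.

(** * Generating functions of overpartitions with bounded parts *)

Definition op_gf N k : {poly R} := \poly_(i < N) (size (enum_op k i))%:R.
Definition nonover_gf N k : {poly R} := \poly_(i < N) (size (enum_nonover k i))%:R.

Lemma op_gfS N j : eqX N (op_gf N j.+1) (nonover_gf N j * (1 + 'X^(j.+1))).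
Proof.
move=> i iN; rewrite mulrDr mulr1 coefD coefMXn !coef_poly iN.
rewrite enum_opS size_cat natrD; congr (_ + _).
rewrite (ltnS i j); case: leqP => // _; rewrite size_map ifT //; lia.
Qed.

(** Multiplying by the denominator replaces the geometric series that counts the copies of the plain
    part [j.+1]. *)
Lemma nonover_gfE N j : eqX N (nonover_gf N j * (1 - 'X^(j.+1))) (op_gf N j).
Proof.
move=> i iN; rewrite mulrBr mulr1 coefB coefMXn !coef_poly iN.
rewrite enum_nonoverE size_cat natrD.
rewrite (ltnS i j); case: leqP => // _ /=; first by rewrite subr0 addr0.
by rewrite size_map ifT ?addrK //; lia.
Qed.

Lemma op_gf_qpoch N k : eqX N (op_gf N k * qpoch R 0 k) (qpochN R k).
Proof.
elim: k => [|k IHk].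
  rewrite qpoch_id mulr1 => i iN; rewrite /qpochN big_geq // coef_poly iN coef1 /=.
  by case: (i == 0)%N.
rewrite qpochS // qpochNS.
apply: (eqX_trans (eqX_mulr _ (@op_gfS N k))).
rewrite (_ : _ * _ = nonover_gf N k * (1 - 'X^(k.+1)) *
                     (qpoch R 0 k * (1 + 'X^(k.+1)))); last by ring.
apply: (eqX_trans (eqX_mulr _ (@nonover_gfE N k))).
by rewrite mulrA; apply: eqX_mulr.
Qed.

Definition pbar_gf N : {poly R} := \poly_(i < N) (pbar i)%:R.

Lemma qpoch_coef0 n : (qpoch R 0 n)`_0 = 1.
Proof.
elim: n => [|n IHn]; first by rewrite qpoch_id coef1.
by rewrite qpochS // coef0M IHn mul1r coefB coef1 coefXn subr0.
Qed.

Lemma pbar_gf_theta n : eqX n.+1 (pbar_gf n.+1 * theta R n) 1.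
Proof.
(* Multiplication by [qpoch R 0 n] turns the overpartition series into [qpochN R n], to which the
   finite Gauss identity applies. *)
apply: (eqX_cancel (qpoch_coef0 n)); rewrite mulr1.
have E : pbar_gf n.+1 = op_gf n.+1 n.
  apply/polyP => i; rewrite !coef_poly; case: ifP => // iN.
  by rewrite (@pbar_size_enum_op n).
rewrite E mulrA [_ * op_gf _ _]mulrC.
apply: (eqX_trans (eqX_mulr _ (@op_gf_qpoch _ _))).
by rewrite mulrC; apply: theta_qpochN_eqX.
Qed.

(** * Powers of phi and sums of squares *)

Definition phi n : {poly R} := \sum_(z <- zball n) 'X^(`|z| ^ 2).

Lemma coef_comp_polyNX p n : (p \Po (- 'X))`_n = (-1) ^+ n * p`_n.
Proof.
rewrite comp_polyE coef_sum.
under eq_bigr => i _ do rewrite exprNn -signr_odd coefZ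
  -polyC1 -polyCN -polyC_exp coefCM signr_odd coefXn.
have [np|pn] := ltnP n (size p).
  rewrite (bigD1 (Ordinal np)) //= big1 ?addr0; last first.
    by move=> j /negbTE; rewrite -val_eqE /= eq_sym => ->; rewrite !mulr0.
  by rewrite eqxx mulr1 mulrC.
rewrite nth_default // mulr0 big1 // => j _.
by rewrite gtn_eqF ?mulr0 // (leq_trans (ltn_ord j)).
Qed.

(** The signs agree because z and z^2 have the same parity. *)
Lemma theta_phi n : theta R n = phi n \Po (- 'X).
Proof.
rewrite /theta /phi rmorph_sum /=; apply: eq_bigr => z _.
rewrite rmorphXn /= comp_polyX [RHS]exprNn -mul_polyC polyC_exp polyCN polyC1.
by rewrite -[in RHS]signr_odd oddX /= signr_odd.
Qed.

Lemma coef_theta_exp n k i : (theta R n ^+ k)`_i = (-1) ^+ i * (phi n ^+ k)`_i.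
Proof. by rewrite theta_phi -rmorphXn /= coef_comp_polyNX. Qed.

(** Terms with |z| > n have exponent z^2 > n. This links the common cutoff [M] to the cutoff n built
    into [r k n]. *)
Lemma phi_eqX n M : (n <= M)%N -> eqX n.+1 (phi M) (phi n).
Proof.
move=> /subnKC <-; elim: (M - n)%N => [|k IHk]; first by rewrite addn0.
apply: eqX_trans IHk => i iN; rewrite addnS /phi !big_cons !coefD abszN !coefXn.
by rewrite (_ : i == _ = false) ?add0r //; nia.
Qed.

Lemma theta_coef0 n : (theta R n)`_0 = 1.
Proof.
rewrite -[theta R n]expr1 coef_theta_exp expr1 mul1r (phi_eqX (leq0n n)) //.
by rewrite /phi big_seq1 coefXn.
Qed.

Lemma coef_sumXn (T : Type) (s : seq T) (e : T -> nat) n :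
  (\sum_(x <- s) 'X^(e x) : {poly R})`_n = (count (fun x => e x == n) s)%:R.
Proof.
rewrite coef_sum -sum1_count [in RHS]big_mkcond natr_sum; apply: eq_bigr => x _.
by rewrite coefXn eq_sym; case: eqP.
Qed.

Lemma sumXn_mul (S T : Type) (s : seq S) (t : seq T) (e : S -> nat) (f : T -> nat) :
  (\sum_(x <- s) 'X^(e x)) * (\sum_(y <- t) 'X^(f y)) =
  \sum_(x <- [seq (y, z) | y <- s, z <- t]) 'X^(e x.1 + f x.2) :> {poly R}.
Proof.
rewrite big_allpairs mulr_suml; apply: eq_bigr => x _.
by rewrite mulr_sumr; apply: eq_bigr => y _; rewrite exprD.
Qed.

Lemma coef_phi4 M m : (phi M ^+ 4)`_m = (size (qsphere M m))%:R.
Proof.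
(* The fourth power is taken as a square of squares to match the pairs of pairs in [quat]. *)
rewrite (exprM _ 2 2) !expr2 {1 2}/phi !sumXn_mul coef_sumXn size_filter.
congr (_%:R); apply: eq_count => -[[a b] [c d]] /=; lia.
Qed.

Lemma phi_ord n : phi n = \sum_(i < 2 * n + 1) 'X^(`|i%:Z - n%:Z| ^ 2).
Proof.
rewrite -(big_map (fun i : 'I__ => i%:Z - n%:Z) predT (fun z => 'X^(`|z| ^ 2))).
apply: perm_big; apply: uniq_perm.
- exact: zball_uniq.
- by rewrite map_inj_uniq ?index_enum_uniq // => i j E; apply: val_inj => /=; lia.
move=> z; rewrite mem_zball; apply/idP/mapP => [zn|[i _ ->]].
  have zb : (`|(z + n%:Z)%R| < 2 * n + 1)%N by lia.
  by exists (Ordinal zb); rewrite ?mem_index_enum //=; lia.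
by have := ltn_ord i; lia.
Qed.

Lemma coef_phi_exp k n : (phi n ^+ k)`_n = (r k n)%:R.
Proof.
(* Writing the power as a product over ['I_k] lets distributivity expand it over functions from
   ['I_k], which are then reindexed by tuples. *)
rewrite phi_ord -[k in LHS]card_ord -prodr_const bigA_distr_bigA.
rewrite (reindex (@finfun_of_tuple _ k)) /=; last first.
  by exists (@tuple_of_finfun _ k) => x _;
    [exact: finfun_of_tupleK | exact: tuple_of_finfunK].
rewrite (eq_bigr (fun t : k.-tuple 'I_(2 * n + 1) =>
  'X^(\sum_(i <- t) `|i%:Z - n%:Z| ^ 2)%N)); last first.
  move=> t _; rewrite big_tuple -expr_sum; congr ('X^_).
  by apply: eq_bigr => i _; rewrite ffunE.
rewrite coef_sumXn /r cardE size_filter; congr (_%:R).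
apply: eq_count => t; rewrite !inE -eqz_nat -(natz (\sum_(i <- t) _)) natr_sum.
by congr (_ == _); apply: eq_bigr => i _; lia.
Qed.
End Truncation.

(** * Reduction modulo 5 *)

Local Notation F := 'F_5.

(** The Frobenius map is additive in characteristic 5, and a fifth power leaves a sign unchanged. *)
Lemma theta_exp5 M :
  theta F M ^+ 5 = \sum_(z <- zball M) (-1) ^+ `|z|%N *: 'X^(5 * `|z| ^ 2).
Proof.
have ch : 5 \in [pchar {poly F}] by rewrite pchar_lalg pchar_Fp.
rewrite -(pFrobenius_autE ch) /theta rmorph_sum; apply: eq_bigr => z _ /=.
rewrite pFrobenius_autE exprZn -exprM -(exprM 'X) [(_ ^ 2 * 5)%N]mulnC.
by rewrite -[in LHS]signr_odd oddM andbT signr_odd.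
Qed.

Lemma coef_theta4_5 M m : (5 * m <= M)%N ->
  (theta F M ^+ 4)`_(5 * m) = (theta F M ^+ 4)`_m.
Proof.
move=> mM; rewrite !coef_theta_exp !coef_phi4 -signr_odd oddM signr_odd; congr (_ * _).
have natr_mod5 := GRing.natr_mod_pchar pchar_F5.
by rewrite -[LHS]natr_mod5 size_qsphere_5 // natr_mod5.
Qed.

Lemma pbar_5n_F5 n : (pbar (5 * n))%:R = (-1) ^+ n * (r 3 n)%:R :> F.
Proof.
pose M := (5 * n)%N; pose A := pbar_gf F M.+1; pose t := theta F M.
have At5 : eqX M.+1 (A * t ^+ 5) (t ^+ 4).
  by have := eqX_mulr (t ^+ 4) (@pbar_gf_theta F M); rewrite mul1r -mulrA -exprS.
(* All exponents of [t ^+ 5] are multiples of 5, so extracting those exponents from [A * t ^+ 5]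
   affects only [A] and turns [t ^+ 5] back into [t]. *)
pose B : {poly F} := \poly_(i < n.+1) A`_(5 * i).
have Bt m : (m < n.+1)%N -> (B * t)`_m = (A * t ^+ 5)`_(5 * m).
  move=> mn; rewrite theta_exp5 /t /theta !mulr_sumr !coef_sum.
  apply: eq_bigr => z _; rewrite -!scalerAr !coefZ !coefMXn; congr (_ * _).
  rewrite ltn_pmul2l //; case: ltnP => // zm.
  by rewrite coef_poly ifT ?mulnBr //; lia.
(* Since [t] has constant term 1, it cancels from B t = t^4, which holds up to q^n by the
   5-dissection of t^4. *)
have /(_ n (ltnSn n)) : eqX n.+1 B (t ^+ 3).
  apply: (eqX_cancel (theta_coef0 F M)) => m mn.
  rewrite mulrC -/t -exprS Bt // At5; last by rewrite /M; lia.
  by rewrite coef_theta4_5 // /M; lia.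
rewrite coef_poly ltnSn coef_poly ltnSn coef_theta_exp => ->; congr (_ * _).
by rewrite (eqX_exp 3 (@phi_eqX F n M _)) ?coef_phi_exp // /M; lia.
Qed.

Local Close Scope ring_scope.

Theorem theorem1 (n : nat) (hn : (1 <= n)%N) :
  ((pbar (5 * n))%:Z = (-1) ^+ n * (r 3 n)%:Z %[mod 5])%Z.
Proof.
apply/eqP; rewrite eqz_mod_dvd (dvdz_pcharf pchar_F5).
by rewrite rmorphB /= rmorphM rmorphXn rmorphN1 /= subr_eq0; apply/eqP/pbar_5n_F5.
Qed.
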